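(* Let $p,q\ge 0$ be integers, and let $\alpha_1,\dots,\alpha_p$, $\beta_1,\dots,\beta_q$, $c$, $(\lambda,\tau)$, $\vec{\mu}(c)$ and the vector polynomials $\vec{P}_n(c)$ be as defined in the context. Let the Stieltjes transform of $\vec{P}_n(c)$ be the formal Laurent series in $1/z$ $$\vec{S}_P(c,z)=\sum_{n=0}^{\infty}\frac{\vec{P}_n(c)}{z^{n+1}}.$$ Then $$\vec{S}_P(c,z)\cdot\vec{\mu}(c)=\frac{1}{z}\;{}_{p+1}F_{q+1}\left[\begin{matrix}-\frac{z}{\lambda+\tau c},\ \alpha_1,\dots,\alpha_p\\ 1-\frac{z}{\lambda+\tau c},\ \beta_1+1,\dots,\beta_q+1\end{matrix};c\right],$$ as formal Laurent series in $1/z$ (the right-hand side being expanded term by term at $z=\infty$, as described in the context).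
   Context: Parameters: $\alpha_1,\dots,\alpha_p\in\mathbb{C}$ and real $\beta_1,\dots,\beta_q>-1$. The complex variable $c$ ranges over: all of $\mathbb{C}$ if $p<q+1$; $|c|<1$ if $p=q+1$; and, if $p>q+1$, it is assumed that one or more of the $\alpha_i$ is a negative integer $-N$ with $N\in\mathbb{N}$ (so that all sums over $x$ below are finite), and $c\ne 0$. Pochhammer symbol: $(a)_0=1$, $(a)_x=a(a+1)\cdots(a+x-1)$ for $x\in\mathbb{N}$. Generalized hypergeometric function: ${}_rF_s\left[\begin{matrix}a_1,\dots,a_r\\ b_1,\dots,b_s\end{matrix};c\right]=\sum_{x=0}^\infty\frac{(a_1)_x\cdots(a_r)_x}{(b_1)_x\cdots(b_s)_x}\frac{c^x}{x!}$. Formal expansion of the right-hand side: for each $x$, the factor $\left(-\frac{z}{\lambda+\tau c}\right)_x/\left(1-\frac{z}{\lambda+\tau c}\right)_x$ is a rational function of $z$, which is expanded in powers of $1/z$ at $z=\infty$; the coefficient of each power of $1/z$ on the right-hand side is the resulting (convergent) sum over $x$. Moments: for $n=0,1,\dots$, $$\mu_n(c)=\sum_{x=0}^{\infty}x^n\,\frac{(\alpha_1)_x\cdots(\alpha_p)_x}{(\beta_1+1)_x\cdots(\beta_q+1)_x}\,\frac{c^x}{x!},$$ with the convention $0^0=1$. Put $\xi=\max\{p-1,q\}$ and $\vec{\mu}(c)=(\mu_0(c),\dots,\mu_\xi(c))^T$. $(\lambda,\tau)=(1,0)$ if $q+1>p$; $(\lambda,\tau)=(1,-1)$ if $q+1=p$;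 $(\lambda,\tau)=(0,1)$ if $q+1<p$. Coefficients $\sigma_0(c),\dots,\sigma_\xi(c)$ are defined by the polynomial identity in an indeterminate $T$ $$T(T+\beta_1)\cdots(T+\beta_q)-c(T+\alpha_1)\cdots(T+\alpha_p)=\varepsilon\left[(\lambda+c\tau)T^{\xi+1}-\sum_{k=0}^{\xi}\sigma_k(c)T^k\right],$$ where $\varepsilon=1$ if $q+1\ge p$ and $\varepsilon=-1$ if $q+1<p$ (empty products equal $1$). The $(\xi+1)\times(\xi+1)$ matrix $\mathbf{M}(c)$, with rows and columns indexed by $0,1,\dots,\xi$: $\mathbf{M}_{\xi,j}=\sigma_j(c)$ for $0\le j\le\xi$; $\mathbf{M}_{i,i+1}=\lambda+c\tau$ for $0\le i\le\xi-1$; all other entries are $0$. The $(\xi+1)$-vector polynomials $\vec{P}_n(c)$ are defined by $\vec{P}_0(c)=(1,0,\dots,0)^T$ and $$\vec{P}_{n+1}=c(\lambda+c\tau)\frac{d\vec{P}_n}{dc}+\left(\mathbf{M}^T-n\tau c\,\mathbf{I}\right)\vec{P}_n,\qquad n=0,1,\dots,$$ with $\mathbf{I}$ the identity matrix. The dot denotes $\vec{u}\cdot\vec{v}=\sum_i u_iv_i$ (no complex conjugation). *)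

(* Defs.v *)
From HB Require Import structures.
From mathcomp Require Import all_boot all_order all_algebra.
From mathcomp Require Import complex.
From mathcomp Require Import boolp classical_sets reals topology normedtype.
From mathcomp Require Import sequences.
Set Implicit Arguments.
Unset Strict Implicit.
Unset Printing Implicit Defensive.

Import Order.TTheory GRing.Theory Num.Theory numFieldNormedType.Exports.

Local Open Scope ring_scope.
Local Open Scope quotient_scope.

Local Notation "p %:F" := (@FracField.tofrac _ p).

(* The topology given by the modulus is attached to the alias R[i]^o. *)
Definition csummable (R : realType) (u : nat -> R[i]) : Prop :=
  cvgn (series u : nat -> R[i]^o).

(* meaningful only when [csummable u] *)
Definition csum (R : realType) (u : nat -> R[i]) : R[i] :=
  limn (series u : nat -> R[i]^o).

Definition pochhammer (A : nzRingType) (a : A) (x : nat) : A :=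
  \prod_(i < x) (a + i%:R).

(* Used both over the complex numbers and over the field of rational functions
   in z. *)
Definition hyp_term (F : fieldType) (a b : seq F) (c : F) (x : nat) : F :=
  (\prod_(u <- a) pochhammer u x) / (\prod_(v <- b) pochhammer v x)
  * (c ^+ x / x`!%:R).

(* A Laurent series in 1/z is given by k : int |-> its coefficient of z^k. *)
Definition laurent (A : Type) := int -> A.

Definition laurent_divz (A : Type) (f : laurent A) : laurent A :=
  fun k => f (k + 1).

(* Expansion at z = oo of a rational function N/D of z: the polynomial part of
   N/D is the quotient of N by D, and the coefficient of z^-m in N/D is the
   constant coefficient of the polynomial part of z^m N/D.  See
   [ratfrac_coefP] below. *)
Definition ratfrac_coef (K : fieldType) (f : {fraction {poly K}}) :
    laurent K :=
  let N := \n_(repr f) in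
  let D := \d_(repr f) in
  fun k => match k with
           | Posz m => (N %/ D)`_m
           | Negz m => (('X^(m.+1) * N) %/ D)`_0
           end.

Lemma divp_shift (K : fieldType) (D A : {poly K}) (m : nat) :
  D != 0 -> (('X * A) %/ D)`_m.+1 = (A %/ D)`_m.
Proof.
move=> D0; rewrite {1}(divp_eq A D) mulrDr divpD mulrA mulpK // coefD.
rewrite mulrC coefMX /= [X in _ + X]nth_default ?addr0 //.
have [->|r0] := eqVneq (A %% D) 0; first by rewrite mulr0 div0p size_poly0.
rewrite size_divp // mulrC size_mulX //.
have : (size (A %% D)%R < size D)%N by rewrite ltn_modp.
case: (size D) => // s; rewrite ltnS /= => h.
by rewrite leq_subLR addnS ltnS (leq_trans h) ?leq_addr.
Qed.

Lemma divp_shiftn (K : fieldType) (D A : {poly K}) (n m : nat) :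
  D != 0 -> (('X^n * A) %/ D)`_(n + m) = (A %/ D)`_m.
Proof.
move=> D0; elim: n => [|n IH]; first by rewrite expr0 mul1r.
by rewrite exprS -mulrA addSn divp_shift.
Qed.

Lemma repr_ratfracE (K : fieldType) (f : {fraction {poly K}}) :
  (\n_(repr f))%:F = f * (\d_(repr f))%:F.
Proof.
elim/quotW: f => x; set r := repr _.
rewrite !piE; apply/eqmodP; rewrite /= FracField.equivfE.
rewrite /FracField.mulf !numden_Ratio ?mulf_neq0 ?oner_neq0 ?denom_ratioP //.
rewrite !mulr1 mul1r /r FracField.equivf_l; apply/eqP.
by rewrite mulrC.
Qed.

Lemma ratfrac_coefE (K : fieldType) (f : {fraction {poly K}}) (N D : {poly K})
    (m n : nat) :
  D != 0 -> f * D%:F = N%:F ->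
  ratfrac_coef f (m%:Z - n%:Z) = (('X^n * N) %/ D)`_m.
Proof.
move=> D0 fE; set r := repr f; have d0 : \d_r != 0 by apply: denom_ratioP.
have cross : \n_r * D = N * \d_r.
  apply/eqP; rewrite -tofrac_eq !tofracM -fE repr_ratfracE -/r.
  by rewrite mulrAC.
have -> : ('X^n * N) %/ D = ('X^n * \n_r) %/ \d_r.
  rewrite -[LHS](divp_pmul2r _ d0 D0) -mulrA -cross mulrA [D * _]mulrC.
  exact: divp_pmul2r.
rewrite /ratfrac_coef -/r; have [nm|mn] := leqP n m.
  by rewrite subzn // -[in RHS](subnKC nm) divp_shiftn.
have -> : m%:Z - n%:Z = Negz (n - m).-1.
  by rewrite NegzE prednK ?subn_gt0 // -subzn ?(ltnW mn) // opprB.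
rewrite prednK ?subn_gt0 // -[in RHS](subnKC (ltnW mn)) exprD -mulrA.
by rewrite -[X in _ = _`_X]addn0 divp_shiftn.
Qed.

(* [ratfrac_coef f] is the Laurent series in 1/z which, multiplied by D,
   gives N whenever f = N / D. *)
Lemma ratfrac_coefP (K : fieldType) (f : {fraction {poly K}}) (N D : {poly K}) :
  D != 0 -> f = N%:F / D%:F ->
  (forall k : int, \sum_(i < size D) D`_i * ratfrac_coef f (k - i%:Z)
                   = if k is Posz m then N`_m else 0)
  /\ (forall m : nat, (size N <= m)%N -> ratfrac_coef f m = 0).
Proof.
move=> D0 fE; have {}fE : f * D%:F = N%:F.
  by rewrite fE mulfVK // tofrac_eq0.
split=> [k|m Nm]; last first.
  rewrite -[Posz m]subr0 (ratfrac_coefE m 0 D0 fE) expr0 mul1r.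
  by rewrite nth_default // (leq_trans (leq_divp _ _)).
have [n [j [kj sj]]] :
    exists n j : nat, k = j%:Z - n%:Z /\ (size D <= j)%N.
  case: k => k.
    exists (size D), (size D + k)%N.
    by rewrite PoszD [_ + k%:Z]addrC addrK leq_addr.
  exists (size D + k.+1)%N, (size D); split=> //.
  by rewrite NegzE PoszD opprD addNKr.
transitivity (('X^n * N) %/ D * D)`_j; last first.
  have /(congr1 (fun p : {poly K} => p`_j)) := divp_eq ('X^n * N) D.
  rewrite coefD [X in _ + X]nth_default ?addr0; last first.
    by rewrite (leq_trans _ sj) // ltnW // ltn_modp.
  move=> <-; rewrite coefXnM kj; case: ltnP => [jn|nj].
    have -> : j%:Z - n%:Z = Negz (n - j).-1 => //.
    by rewrite NegzE prednK ?subn_gt0 // -subzn ?(ltnW jn) // opprB.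
  by rewrite subzn.
rewrite mulrC coefM.
rewrite [RHS](bigID (fun i : 'I_j.+1 => (i < size D)%N)) /= [X in _ + X]big1.
  rewrite addr0 (big_ord_widen_cond _ xpredT
    (fun i => D`_i * ratfrac_coef f (k - i%:Z)) (leqW sj)).
  apply: eq_bigr => i iD; congr (_ * _).
  rewrite -(ratfrac_coefE (j - i) n D0 fE); congr (ratfrac_coef _ _).
  have <- : j%:Z - i%:Z = (j - i)%N%:Z by rewrite subzn // (leq_trans (ltnW iD)).
  by rewrite kj addrAC.
by move=> i; rewrite -leqNgt => iD; rewrite [D`_i]nth_default ?mul0r.
Qed.

Definition xi (p q : nat) : nat := maxn p.-1 q.

Definition lambda (A : nzRingType) (p q : nat) : A :=
  if (q.+1 < p)%N then 0 else 1.

Definition tau (A : nzRingType) (p q : nat) : A :=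
  if (p < q.+1)%N then 0 else if p == q.+1 then -1 else 1.

Definition epsilon (A : nzRingType) (p q : nat) : A :=
  if (p <= q.+1)%N then 1 else -1.

(* here 'X is c *)
Definition lambda_ctau (K : fieldType) (p q : nat) : {poly K} :=
  lambda _ p q + 'X * tau _ p q.

(* In {poly {poly K}} the outer indeterminate 'X is T and the inner one,
   'X%:P, is c. *)
Definition T_poly (K : fieldType) (p q : nat)
    (alpha : p.-tuple K) (beta : q.-tuple K) : {poly {poly K}} :=
  'X * \prod_(j < q) ('X + (tnth beta j)%:P%:P)
  - 'X%:P * \prod_(i < p) ('X + (tnth alpha i)%:P%:P).

Definition sigma (K : fieldType) (p q : nat)
    (alpha : p.-tuple K) (beta : q.-tuple K) (k : nat) : {poly K} :=
  ((lambda_ctau K p q)%:P * 'X^((xi p q).+1)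
   - (epsilon _ p q)%:P * T_poly alpha beta)`_k.

Lemma coef_monic_ge (A : nzRingType) (f : {poly A}) (n m : nat) :
  f \is monic -> size f = n.+1 -> (n <= m)%N -> f`_m = (m == n)%:R.
Proof.
move=> /monicP fm sf; rewrite leq_eqVlt => /predU1P[<-|nm].
  by rewrite eqxx -fm lead_coefE sf.
by rewrite nth_default ?sf // gtn_eqF.
Qed.

Lemma coef_T_poly_ge (K : fieldType) (p q : nat)
    (alpha : p.-tuple K) (beta : q.-tuple K) (m : nat) :
  (xi p q < m)%N ->
  (T_poly alpha beta)`_m = (m == q.+1)%:R - (m == p)%:R *: 'X.
Proof.
rewrite /xi gtn_max => /andP[pm qm].
have mX (r : nat) (t : r.-tuple K) :
    \prod_(i < r) ('X + (tnth t i)%:P%:P : {poly {poly K}}) \is monic /\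
    size (\prod_(i < r) ('X + (tnth t i)%:P%:P : {poly {poly K}})) = r.+1.
  have -> : \prod_(i < r) ('X + (tnth t i)%:P%:P : {poly {poly K}}) =
            \prod_(i < r) ('X - (- (tnth t i)%:P)%:P).
    by apply: eq_bigr => i _; rewrite polyCN opprK.
  by split; [apply: monic_prod_XsubC | rewrite size_prod_XsubC /index_enum -enumT size_enum_ord].
have [mB sB] := mX q beta; have [mA sA] := mX p alpha.
rewrite /T_poly coefB coefCM.
rewrite (coef_monic_ge mA sA) ?(leq_trans (leqSpred p)) //.
case: m pm qm => // m pm qm.
rewrite coefXM /= (coef_monic_ge mB sB) //.
rewrite eqSS; congr (_ - _).
by case: eqP => _; rewrite ?(mulr1, mulr0, scale1r, scale0r).
Qed.

(* the identity in T that defines the sigma_k *)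
Lemma sigmaP (K : fieldType) (p q : nat)
    (alpha : p.-tuple K) (beta : q.-tuple K) :
  T_poly alpha beta =
    (epsilon _ p q)%:P *
    ((lambda_ctau K p q)%:P * 'X^((xi p q).+1)
     - \sum_(k < (xi p q).+1) (sigma alpha beta k)%:P * 'X^k).
Proof.
set Q := (lambda_ctau K p q)%:P * 'X^((xi p q).+1)
         - (epsilon _ p q)%:P * T_poly alpha beta.
have -> : \sum_(k < (xi p q).+1) (sigma alpha beta k)%:P * 'X^k = Q.
  have sQ : (size Q <= (xi p q).+1)%N.
    apply/leq_sizeP => m xm; rewrite coefB !coefCM coefXn coef_T_poly_ge //.
    rewrite /lambda_ctau /lambda /tau /epsilon /xi in xm *.
    case: (ltngtP p q.+1) xm => [pq|qp|->] xm.
    - rewrite [maxn _ _](maxn_idPr _) ?(leq_trans (leq_pred _)) // in xm *.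
      by rewrite (gtn_eqF (leq_trans pq xm)) mulr0 addr0 scale0r subr0 subrr.
    - case: p qp alpha xm Q => // p qp _ xm _; rewrite ltnS in qp.
      rewrite [maxn _ _](maxn_idPl (ltnW qp)) in xm *.
      rewrite (gtn_eqF (leq_trans (qp : q.+1 < p.+1)%N xm)).
      rewrite sub0r mulN1r opprK mulr1 add0r.
      by case: eqP; rewrite ?scale1r ?scale0r ?mulr1 ?mulr0 subrr.
    - rewrite maxnn mulrN1 mul1r.
      by case: eqP => _; rewrite ?(scale1r, scale0r, mulr1, mulr0, subr0, subrr).
  transitivity (\poly_(k < (xi p q).+1) Q`_k : {poly {poly K}}).
    by rewrite poly_def; apply: eq_bigr => k _; rewrite mul_polyC.
  apply/polyP => m; rewrite coef_poly; case: ltnP => // xm.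
  by rewrite nth_default // (leq_trans sQ).
rewrite /Q opprB addrC subrK mulrA -polyCM /epsilon.
by case: ifP; rewrite ?mulrNN mulr1 polyC1 mul1r.
Qed.

Definition M_mx (K : fieldType) (p q : nat)
    (alpha : p.-tuple K) (beta : q.-tuple K) : 'M[{poly K}]_((xi p q).+1) :=
  \matrix_(i, j)
    if i == ord_max then sigma alpha beta j
    else if j == i.+1 :> nat then lambda_ctau K p q
    else 0.

(* The entries of P_n are polynomials in c, so d/dc is the formal derivative. *)
Fixpoint P_vec (K : fieldType) (p q : nat)
    (alpha : p.-tuple K) (beta : q.-tuple K) (n : nat) :
    'cV[{poly K}]_((xi p q).+1) :=
  match n with
  | 0%N => \col_i (i == ord0)%:R
  | m.+1 => let P := P_vec alpha beta m in
            ('X * lambda_ctau K p q) *: map_mx (fun f => f^`()) P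
            + ((M_mx alpha beta)^T - (m%:R * tau _ p q * 'X)%:M) *m P
  end.

Definition dot (A : nzRingType) (m : nat) (u v : 'cV[A]_m) : A :=
  \sum_(i < m) u i 0 * v i 0.

(* S_P(c, z) = sum_n P_n(c) / z^(n+1); note that Negz n is -(n+1). *)
Definition stieltjes (K : fieldType) (p q : nat)
    (alpha : p.-tuple K) (beta : q.-tuple K) (c : K) :
    laurent 'cV[K]_((xi p q).+1) :=
  fun k => match k with
           | Posz _ => 0
           | Negz n => map_mx (fun f => f.[c]) (P_vec alpha beta n)
           end.

Definition shift_beta (R : realType) (q : nat) (beta : q.-tuple R) : seq R[i] :=
  [seq (b%:C)%C + 1 | b <- beta].

Definition moment_term (R : realType) (p q : nat)
    (alpha : p.-tuple R[i]) (beta : q.-tuple R) (c : R[i]) (n x : nat) : R[i] :=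
  x%:R ^+ n * hyp_term alpha (shift_beta beta) c x.

Definition moment (R : realType) (p q : nat)
    (alpha : p.-tuple R[i]) (beta : q.-tuple R) (c : R[i]) (n : nat) : R[i] :=
  csum (moment_term alpha beta c n).

Definition moment_vec (R : realType) (p q : nat)
    (alpha : p.-tuple R[i]) (beta : q.-tuple R) (c : R[i]) :
    'cV[R[i]]_((xi p q).+1) :=
  \col_i moment alpha beta c i.

(* x-th term of the (p+1)F(q+1) series of the right-hand side, as a rational
   function of z *)
Definition rhs_term (R : realType) (p q : nat)
    (alpha : p.-tuple R[i]) (beta : q.-tuple R) (c : R[i]) (x : nat) :
    {fraction {poly R[i]}} :=
  let C (a : R[i]) : {fraction {poly R[i]}} := a%:P%:F in
  let w := 'X%:F / C (lambda _ p q + tau _ p q * c) in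
  hyp_term (- w :: [seq C a | a <- alpha])
           (1 - w :: [seq C b | b <- shift_beta beta]) (C c) x.

Definition rhs_series (R : realType) (p q : nat)
    (alpha : p.-tuple R[i]) (beta : q.-tuple R) (c : R[i]) : laurent R[i] :=
  fun k => csum (fun x => ratfrac_coef (rhs_term alpha beta c x) k).

(* Main.v *)
Require Import Defs.
From HB Require Import structures.
From mathcomp Require Import all_boot all_order all_algebra.
From mathcomp Require Import complex.
From mathcomp Require Import boolp classical_sets reals topology normedtype.
From mathcomp Require Import sequences.
From mathcomp Require Import ring lra.
Set Implicit Arguments.
Unset Strict Implicit.
Unset Printing Implicit Defensive.
Import Order.TTheory GRing.Theory Num.Theory numFieldNormedType.Exports.
Local Open Scope ring_scope.


(** Write L for lambda + c tau and a_x c^x for the x-th term of the moment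
series, so that mu_n(c) is the sum over x of x^n a_x c^x.

On the right-hand side the two Pochhammer symbols containing z telescope:
with w = z / L,
  (-w)_x / (1 - w)_x = w / (w - x) = z / (z - L x),
so the coefficient of z^(-n) in the x-th term is L^n x^n a_x c^x
([rhs_termE], [ratfrac_coef_geom]).  The theorem is therefore equivalent to
  P_n(c) . mu(c) = L^n mu_n(c)   for every n.

This is an identity between power series in c, proved by induction on n by
applying c L d/dc to both sides.  Two facts make the recursion of P_n match:
c d/dc maps mu_n to mu_(n+1), and L c d/dc mu = M mu.  The last row of the
latter is L mu_(xi+1) = sum_k sigma_k mu_k: by definition of the sigma_k the
difference of the two sides is, up to sign, the sum of
x prod_j (x + beta_j) - c prod_i (x + alpha_i) against a_x c^x, which
telescopes because consecutive a_x satisfy a Pearson equation.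

No power series is differentiated analytically.  The moments are replaced by
polynomials in an indeterminate c truncated at degree D, on which the
derivative is formal and every error is divisible by c^D ([dvdp_P_vec]);
reading off one coefficient at a time gives an exact identity of Cauchy
products ([conv_P_vec]).  It is summed at the given c through
[has_csum_conv]: multiplying a power series by a polynomial preserves mere
convergence at a point.  Convergence of the moments is the ratio test when
p <= q + 1 ([csummable_hyp_term]); when p > q + 1 the series are finite sums
([hyp_term_negn]). *)

(** * Vector polynomials and the formal moments *)

(** The Euler operator does not lower the order of vanishing at 0, unlike the
bare derivative; this is why the recursion of the P_n, where d/dc comes with
a factor c, can be studied modulo a power of c. *)
Lemma dvdp_Xn_eulerop (K : fieldType) (D : nat) (f : {poly K}) :
  'X^D %| f -> 'X^D %| 'X * f^`().
Proof.
case/dvdpP=> g ->; rewrite derivM derivXn.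
have -> : 'X * (g^`() * 'X^D + g * ('X^(D.-1) *+ D))
          = ('X * g^`() + g *+ D) * 'X^D.
  rewrite mulrDr mulrDl mulrA mulrnAr mulrnAr mulrnAl; congr (_ + _).
  by case: D => // D; rewrite mulrCA -exprS.
exact: dvdp_mull.
Qed.

(** The coefficient of 'X^d in the product of f with the power series whose
coefficients are b; terms of b beyond index d cannot contribute. *)
Definition conv (K : fieldType) (f : {poly K}) (b : nat -> K) d : K :=
  (f * \poly_(x < d.+1) b x)`_d.

Lemma coef_mul_trunc (K : fieldType) (f : {poly K}) (b : nat -> K) m d :
  (d < m)%N -> (f * \poly_(x < m) b x)`_d = conv f b d.
Proof.
move=> dm; rewrite /conv !coefM; apply: eq_bigr => i _; rewrite !coef_poly.
by rewrite ltnS leq_subr (leq_ltn_trans (leq_subr _ _)).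
Qed.

(** [a x] is the coefficient of c^x in the moment of order 0, and its Pearson
equation is what makes the sums below telescope. *)
Section FormalIdentity.
Variables (K : fieldType) (p q : nat) (alpha : p.-tuple K) (beta : q.-tuple K).
Variable a : nat -> K.
Hypothesis pearson : forall x,
  x.+1%:R * \prod_(j < q) (x.+1%:R + tnth beta j) * a x.+1
  = \prod_(i < p) (x%:R + tnth alpha i) * a x.

Definition moment_poly (n D : nat) : {poly K} :=
  \poly_(x < D) (x%:R ^+ n * a x).

Lemma eulerop_moment_poly n D : 'X * (moment_poly n D)^`() = moment_poly n.+1 D.
Proof.
apply/polyP => -[|x]; rewrite coefXM [RHS]coef_poly /=.
  by rewrite exprS !mul0r if_same.
rewrite coef_deriv coef_poly; case: ifP => _; last by rewrite mul0rn.
by rewrite exprS -mulrA mulr_natl.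
Qed.

Lemma horner_T_poly (t : K) :
  (T_poly alpha beta).[t%:P]
  = (t * \prod_(j < q) (t + tnth beta j))%:P
    - 'X * (\prod_(i < p) (t + tnth alpha i))%:P.
Proof.
rewrite /T_poly !hornerE !horner_prod !polyCM !rmorph_prod /=.
by congr (_ * _ - _ * _); apply: eq_bigr => i _; rewrite !hornerE polyCD.
Qed.

Lemma horner_sigma (t : {poly K}) :
  (T_poly alpha beta).[t]
  = epsilon _ p q * (lambda_ctau K p q * t ^+ (xi p q).+1
                     - \sum_(k < (xi p q).+1) sigma alpha beta k * t ^+ k).
Proof.
rewrite sigmaP !(hornerM, hornerD, hornerN, hornerC, hornerXn) horner_sum.
by under eq_bigr => k _ do rewrite !(hornerM, hornerC, hornerXn).
Qed.

(** By the Pearson equation the x-th term is G x - G x.+1 with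
G x = x (x + beta_1) ... (x + beta_q) a_x c^x.  Since G 0 = 0, only the
boundary term G D survives. *)
Lemma sum_T_poly D :
  \sum_(x < D) (a x *: 'X^x) * (T_poly alpha beta).[(x%:R)%:P]
  = - ((D%:R * \prod_(j < q) (D%:R + tnth beta j) * a D) *: 'X^D).
Proof.
pose G x : {poly K} :=
  (x%:R * \prod_(j < q) (x%:R + tnth beta j) * a x) *: 'X^x.
rewrite -/(G D) -[G D]subr0 -[X in _ - X](_ : G 0%N = 0); last first.
  by rewrite /G !mul0r scale0r.
rewrite -(telescope_sumr G (leq0n D)) big_mkord -sumrN.
apply: eq_bigr => x _; rewrite horner_T_poly opprB /G pearson exprS.
rewrite -!mul_polyC !polyCM; ring.
Qed.

(** The relation L mu_(xi+1) = sum_k sigma_k mu_k between truncated moments.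
Substituting x for T in the identity that defines the sigma_k and summing
against a_x c^x gives the telescoping sum of [sum_T_poly]. *)
Lemma dvdp_sum_sigma D :
  'X^D %| \sum_(k < (xi p q).+1) sigma alpha beta k * moment_poly k D
          - lambda_ctau K p q * moment_poly (xi p q).+1 D.
Proof.
have -> : \sum_(k < (xi p q).+1) sigma alpha beta k * moment_poly k D
          - lambda_ctau K p q * moment_poly (xi p q).+1 D
  = - epsilon _ p q *
    \sum_(x < D) (a x *: 'X^x) * (T_poly alpha beta).[(x%:R)%:P].
  have mE n : moment_poly n D = \sum_(x < D) (a x *: 'X^x) * (x%:R)%:P ^+ n.
    rewrite /moment_poly poly_def; apply: eq_bigr => x _.
    by rewrite -!mul_polyC polyCM -polyC_exp; ring.
  under eq_bigr => k _ do rewrite mE mulr_sumr.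
  rewrite exchange_big mE !mulr_sumr -sumrB; apply: eq_bigr => x _.
  rewrite horner_sigma; set S := \sum_(k < _) sigma _ _ k * x%:R%:P ^+ k.
  set L := lambda_ctau K p q.
  have eps2 : (epsilon _ p q : {poly K}) * epsilon _ p q = 1.
    by rewrite /epsilon; case: ifP; rewrite ?mulrNN mulr1.
  transitivity ((a x *: 'X^x) * (S - L * x%:R%:P ^+ (xi p q).+1)).
    rewrite mulrBr mulr_sumr mulrCA; congr (_ - _).
    by apply: eq_bigr => k _; rewrite mulrCA.
  by rewrite mulrCA mulNr mulrA eps2 mul1r opprB.
by rewrite sum_T_poly -mul_polyC -mulrN; do 2!apply: dvdp_mull; rewrite dvdpNr.
Qed.

(** L c d/dc mu = M mu for truncated moments.  The rows of M other than the
last hold exactly, the last one is [dvdp_sum_sigma]. *)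
Lemma dvdp_col_M_mx D (j : 'I_(xi p q).+1) :
  'X^D %| \sum_i M_mx alpha beta j i * moment_poly i D
          - lambda_ctau K p q * moment_poly j.+1 D.
Proof.
have [->|jm] := eqVneq j ord_max.
  under eq_bigr => i _ do rewrite mxE eqxx.
  exact: dvdp_sum_sigma.
have jx : (j.+1 < (xi p q).+1)%N.
  rewrite ltn_neqAle ltn_ord andbT; apply: contraNneq jm => -[jE].
  exact/eqP/val_inj.
rewrite (bigD1 (Ordinal jx)) //= mxE (negPf jm) eqxx big1.
  by rewrite addr0 subrr dvdp0.
move=> i; rewrite -val_eqE /= => /negPf ij.
by rewrite mxE (negPf jm) ij mul0r.
Qed.

Lemma deriv_lambda_ctau : (lambda_ctau K p q)^`() = tau _ p q.
Proof.
have [l lE] : exists l : K, lambda {poly K} p q = l%:P.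
  by rewrite /lambda; case: ifP; [exists 0 | exists 1]; rewrite ?polyC0 ?polyC1.
have [t tE] : exists t : K, tau {poly K} p q = t%:P.
  rewrite /tau; case: ifP; [exists 0; by rewrite polyC0 |case: ifP => _ _].
    by exists (-1); rewrite polyCN polyC1.
  by exists 1; rewrite polyC1.
rewrite /lambda_ctau lE tE derivD derivC derivM derivX derivC.
by rewrite mulr0 addr0 mul1r add0r.
Qed.

Lemma P_vecS n i :
  P_vec alpha beta n.+1 i 0
  = 'X * lambda_ctau K p q * (P_vec alpha beta n i 0)^`()
    + \sum_j M_mx alpha beta j i * P_vec alpha beta n j 0
    - n%:R * tau _ p q * 'X * P_vec alpha beta n i 0.
Proof.
rewrite /= mulmxBl mul_scalar_mx addrA 4!mxE [(_ *m _) _ _]mxE !mxE.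
by congr (_ + _ - _); apply: eq_bigr => j _; rewrite [_^T _ _]mxE.
Qed.

(** Let F_n be the difference P_n . mu - L^n mu_n of truncated moments.  The
Leibniz rule and the recursion of P_n give
  F_(n+1) = L c F_n' - n tau c F_n + P_n . (M mu - L c mu'),
and c^D divides each of the three terms. *)
Lemma dvdp_P_vec n D :
  'X^D %| \sum_i P_vec alpha beta n i 0 * moment_poly i D
          - lambda_ctau K p q ^+ n * moment_poly n D.
Proof.
elim: n => [|n IH].
  rewrite (bigD1 ord0) //= big1 ?addr0 => [|i /negPf i0].
    by rewrite mxE eqxx expr0 subrr dvdp0.
  by rewrite mxE i0 mul0r.
set L := lambda_ctau K p q in IH *; set P := P_vec alpha beta n in IH *.
set t := tau {poly K} p q.
have -> : \sum_i P_vec alpha beta n.+1 i 0 * moment_poly i D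
          - L ^+ n.+1 * moment_poly n.+1 D
  = L * ('X * (\sum_i P i 0 * moment_poly i D - L ^+ n * moment_poly n D)^`())
    - n%:R * t * 'X * (\sum_i P i 0 * moment_poly i D - L ^+ n * moment_poly n D)
    + \sum_j P j 0 * (\sum_i M_mx alpha beta j i * moment_poly i D
          - L * moment_poly j.+1 D).
  rewrite derivB raddf_sum /=.
  under [X in _ = _ + X]eq_bigr => j _ do rewrite mulrBr mulr_sumr.
  rewrite sumrB exchange_big /=.
  have -> : \sum_i P_vec alpha beta n.+1 i 0 * moment_poly i D
    = 'X * L * \sum_i (P i 0)^`() * moment_poly i D
      + \sum_i \sum_j P j 0 * (M_mx alpha beta j i * moment_poly i D)
      - n%:R * t * 'X * \sum_i P i 0 * moment_poly i D.
    rewrite !mulr_sumr -big_split -sumrB /=; apply: eq_bigr => i _.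
    rewrite P_vecS -/P -/t -/L mulrBl mulrDl mulr_suml.
    rewrite [X in _ + X - _](eq_bigr
        (fun j => P j 0 * (M_mx alpha beta j i * moment_poly i D))).
      by ring.
    by move=> j _; ring.
  have -> : 'X * (\sum_i (P i 0 * moment_poly i D)^`()
                  - (L ^+ n * moment_poly n D)^`())
     = 'X * \sum_i (P i 0)^`() * moment_poly i D
       + \sum_i P i 0 * moment_poly i.+1 D
       - 'X * (L ^+ n)^`() * moment_poly n D - L ^+ n * moment_poly n.+1 D.
    rewrite mulrBr mulr_sumr mulr_sumr -big_split /=.
    rewrite derivM mulrDr [X in _ - (_ + X)]mulrCA eulerop_moment_poly.
    rewrite opprD addrA mulrA.
    congr (_ - _ - _); apply: eq_bigr => i _.
    by rewrite derivM -eulerop_moment_poly; ring.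
  have LE : L * ('X * (L ^+ n)^`()) = n%:R * t * 'X * L ^+ n.
    case: n {IH P} => [|n]; first by rewrite expr0 derivC !mul0r !mulr0.
    rewrite deriv_exp deriv_lambda_ctau -/t -/L /= [in RHS]exprS -mulr_natl.
    by rewrite -/L; ring.
  have -> : \sum_j P j 0 * (L * moment_poly j.+1 D)
     = L * \sum_j P j 0 * moment_poly j.+1 D.
    by rewrite mulr_sumr; apply: eq_bigr => j _; ring.
  rewrite exprS.
  set S1 := \sum_i (P i 0)^`() * _; set S2 := \sum_i \sum_j _.
  set S3 := \sum_i P i 0 * moment_poly i D.
  transitivity ('X * L * S1 + S2 - n%:R * t * 'X * S3
    - L * L ^+ n * moment_poly n.+1 D
    + (n%:R * t * 'X * L ^+ n - L * ('X * (L ^+ n)^`())) * moment_poly n D).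
    by rewrite LE subrr mul0r addr0.
  by ring.
rewrite dvdp_add ?dvdp_sub //.
- by apply: dvdp_mull; apply: dvdp_Xn_eulerop.
- exact: dvdp_mull.
- apply: (big_ind (fun f => 'X^D %| f)) => [|f g|j _]; rewrite ?dvdp0 //.
    exact: dvdp_add.
  by apply: dvdp_mull; apply: dvdp_col_M_mx.
Qed.

(** Truncating beyond the coefficient under consideration removes the error
term of [dvdp_P_vec]. *)
Lemma conv_P_vec n d :
  \sum_i conv (P_vec alpha beta n i 0) (fun x => x%:R ^+ i * a x) d
  = conv (lambda_ctau K p q ^+ n) (fun x => x%:R ^+ n * a x) d.
Proof.
have /dvdpP [g gE] := dvdp_P_vec n d.+1.
apply/eqP; rewrite -subr_eq0 /conv -coef_sum -coefB gE coefMXn ltnS leqnn.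
exact: eqxx.
Qed.

End FormalIdentity.

(** * Terms of hypergeometric series *)

Lemma pochhammerS (F : fieldType) (u : F) x :
  pochhammer u x.+1 = pochhammer u x * (u + x%:R).
Proof. exact: big_ord_recr. Qed.

Lemma hyp_termS (F : fieldType) (a b : seq F) (c : F) x :
  hyp_term a b c x.+1
  = hyp_term a b c x * (\prod_(u <- a) (u + x%:R) / \prod_(v <- b) (v + x%:R)
                        * (c / x.+1%:R)).
Proof.
rewrite /hyp_term.
under eq_bigr => u _ do rewrite pochhammerS.
under [X in _ / X]eq_bigr => u _ do rewrite pochhammerS.
rewrite !big_split /= exprSr factS natrM !invfM.
move: (\prod_(_ <- _) _) (\prod_(_ <- _) _)^-1 => A B.
set A' := (\prod_(_ <- _) _); set B' := (\prod_(_ <- _) _)^-1.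
set e := _.+1%:R^-1; set g := _%:R^-1.
ring.
Qed.

Lemma hyp_term_scale (F : fieldType) (a b : seq F) (c : F) x :
  hyp_term a b c x = hyp_term a b 1 x * c ^+ x.
Proof. by rewrite /hyp_term expr1n mul1r mulrCA mulrC. Qed.

(** Both (-w)_x (x - w) and (-w) (1 - w)_x are the product of the i - w for
i from 0 to x.  The hypothesis keeps (1 - w)_x from vanishing; it holds for
w proportional to the indeterminate z. *)
Lemma pochhammer_ratio (F : fieldType) (w : F) x :
  (forall i : nat, w != i%:R) ->
  pochhammer (- w) x / pochhammer (1 - w) x = w / (w - x%:R).
Proof.
move=> wN; have p0 : pochhammer (1 - w) x != 0.
  apply/prodf_neq0 => i _; rewrite addrAC -mulrS subr_eq0 eq_sym.
  exact: wN.
have w0 : w - x%:R != 0 by rewrite subr_eq0.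
apply/eqP; rewrite eqr_div //; apply/eqP; apply: oppr_inj.
rewrite -mulrN opprB [x%:R - w]addrC -pochhammerS /pochhammer big_ord_recl /=.
rewrite addr0 mulNr; congr (- (_ * _)); apply: eq_bigr => i _.
by rewrite /bump /= mulrS addrA [- w + 1]addrC.
Qed.

Lemma hyp_term_cons (F : fieldType) (a b : seq F) (u v c : F) x :
  hyp_term (u :: a) (v :: b) c x
  = pochhammer u x / pochhammer v x * hyp_term a b c x.
Proof. by rewrite /hyp_term !big_cons -mulf_div !mulrA. Qed.

Lemma hyp_term_map (F F' : fieldType) (f : {rmorphism F -> F'})
    (a b : seq F) c x :
  hyp_term (map f a) (map f b) (f c) x = f (hyp_term a b c x).
Proof.
have pE u : pochhammer (f u) x = f (pochhammer u x).
  by rewrite rmorph_prod; apply: eq_bigr => i _; rewrite rmorphD rmorph_nat.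
rewrite /hyp_term !big_map rmorphM !fmorph_div rmorphXn rmorph_nat !rmorph_prod.
by congr (_ / _ * _); apply: eq_bigr => u _; rewrite pE.
Qed.

Lemma hyp_term_negn (F : fieldType) (a b : seq F) c N x :
  - N%:R \in a -> (N < x)%N -> hyp_term a b c x = 0.
Proof.
move=> aN Nx; rewrite /hyp_term.
suff -> : \prod_(u <- a) pochhammer u x = 0 by rewrite !mul0r.
apply/eqP; rewrite prodf_seq_eq0; apply/hasP; exists (- N%:R) => //=.
by apply/prodf_eq0; exists (Ordinal Nx); rewrite //= addNr.
Qed.

(** * Series of complex numbers *)

Section ComplexSeries.
Variable R : realType.
Local Notation C := R[i].
Local Notation Re := (@complex.Re R).
Local Notation Im := (@complex.Im R).
Local Notation normc := (@ComplexField.Normc.normc R).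

Definition has_csum (u : nat -> C) (s : C) : Prop :=
  ((series u : nat -> R[i]^o) @ \oo --> (s : R[i]^o))%classic.

Lemma has_csum_csum u : csummable u -> has_csum u (csum u).
Proof. by []. Qed.

Lemma has_csum_summable u s : has_csum u s -> csummable u.
Proof. by move=> us; apply/cvg_ex; exists s. Qed.

Lemma has_csum_unique u s : has_csum u s -> csum u = s.
Proof. by move=> us; apply: cvg_lim us; apply: norm_hausdorff. Qed.

Lemma has_csum0 : has_csum (fun=> 0) 0.
Proof.
rewrite /has_csum (_ : series _ = fun=> 0); first exact: cvg_cst.
by apply/funext => n; rewrite seriesEnat /= big1.
Qed.

Lemma has_csumD u v s t :
  has_csum u s -> has_csum v t -> has_csum (fun x => u x + v x) (s + t).
Proof.
move=> us vt; rewrite /has_csum (_ : series _ = fun n => series u n + series v n).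
  exact: (@cvgD C R[i]^o _ _ _ _ _ _ _ us vt).
by apply/funext => n; rewrite !seriesEnat /= big_split.
Qed.

Lemma has_csumZ k u s : has_csum u s -> has_csum (fun x => k * u x) (k * s).
Proof.
move=> us; rewrite /has_csum (_ : series _ = fun n => k * series u n).
  exact: (@cvgMl_tmp C).
by apply/funext => n; rewrite !seriesEnat /= mulr_sumr.
Qed.

Lemma has_csum_sum (I : Type) (r : seq I) (u : I -> nat -> C) (s : I -> C) :
  (forall i, has_csum (u i) (s i)) ->
  has_csum (fun x => \sum_(i <- r) u i x) (\sum_(i <- r) s i).
Proof.
move=> us; elim: r => [|i r IH].
  rewrite big_nil (_ : (fun _ => _) = fun=> 0); first exact: has_csum0.
  by apply/funext => x; rewrite big_nil.
rewrite big_cons (_ : (fun _ => _) = fun x => u i x + \sum_(j <- r) u j x).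
  exact: (has_csumD (us i) IH).
by apply/funext => x; rewrite big_cons.
Qed.

Lemma has_csum_shift u s :
  has_csum u s -> has_csum (fun x => if x is y.+1 then u y else 0) s.
Proof.
move=> us; rewrite /has_csum -cvg_shiftS (_ : [sequence _]_n = series u) //.
by apply/funext => n; rewrite !seriesEnat /= big_nat_recl // add0r.
Qed.

(** Multiplying by a polynomial only shifts and combines finitely many copies
of the series, so conditional convergence is enough; the induction is
Horner's scheme for f. *)
Lemma has_csum_conv (f : {poly C}) b c s :
  has_csum (fun x => b x * c ^+ x) s ->
  has_csum (fun d => conv f b d * c ^+ d) (f.[c] * s).
Proof.
move=> bs; elim/poly_ind: f => [|f k IH].
  rewrite horner0 mul0r (_ : (fun d => _) = fun=> 0); first exact: has_csum0.
  by apply/funext => d; rewrite /conv mul0r coef0 mul0r.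
rewrite !hornerE mulrDl -mulrA mulrCA.
have -> : (fun d => conv (f * 'X + k%:P) b d * c ^+ d)
  = (fun d => c * (if d is e.+1 then conv f b e * c ^+ e else 0)
              + k * (b d * c ^+ d)).
  apply/funext => d; rewrite [in LHS]/conv mulrDl coefD coefCM coef_poly ltnSn.
  rewrite mulrAC coefMX mulrDl mulrA; congr (_ + _).
  case: d => [|d]; first by rewrite mul0r mulr0.
  by rewrite coef_mul_trunc // exprS mulrCA.
by apply: has_csumD; [apply/has_csumZ/has_csum_shift | apply: has_csumZ].
Qed.

Lemma cvg_real_complex (f : nat -> R) (a : R) :
  (f @ \oo --> a ->
  (fun n => (f n)%:C%C : R[i]^o) @ \oo --> (a%:C%C : R[i]^o))%classic.
Proof.
move=> fa; apply/cvgrPdist_lt => /= e e0.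
have eE : (Re (e : C))%:C%C = e :> C by apply/RRe_real/gtr0_real.
have {e0} : 0 < Re (e : C) by rewrite -ltcR eE.
move/cvgrPdist_lt: fa => /[apply]; apply: filterS => n.
by rewrite -ltcR eE -rmorphB /= normc_def /= expr0n addr0 sqrtr_sqr.
Qed.

Lemma normc_ge_Im (z : C) : `|Im z| <= normc z.
Proof. by case: z => a b /=; rewrite -sqrtr_sqr ler_wsqrtr // lerDr sqr_ge0. Qed.

Lemma normc_ge0 (z : C) : 0 <= normc z.
Proof. by case: z => a b; apply: sqrtr_ge0. Qed.

(** Comparison is applied to the real and imaginary parts, where the
completeness of R provides the limit. *)
Lemma csummable_dom (u : nat -> C) (v : nat -> R) :
  (forall n, normc (u n) <= v n) -> cvgn (series v) -> csummable u.
Proof.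
move=> uv cv.
have dom (f : nat -> R) : (forall n, `|f n| <= normc (u n)) -> cvgn (series f).
  move=> fu; apply: (@normed_cvg R R^o).
  apply: series_le_cvg cv => n.
  - exact: normr_ge0.
  - exact: (le_trans (normc_ge0 (u n)) (uv n)).
  - exact: (le_trans (fu n) (uv n)).
have cRe : cvgn (series (fun n => Re (u n))).
  apply: dom => n; have := normc_ge_Re (u n); rewrite lecR //.
have cIm : cvgn (series (fun n => Im (u n))).
  by apply: dom => n; apply: normc_ge_Im.
move: cRe cIm => /cvg_real_complex cRe /cvg_real_complex cIm.
apply/cvg_ex; eexists.
rewrite (_ : series u = fun n => (series (fun n => Re (u n)) n)%:C%C
    + 'i%C * (series (fun n => Im (u n)) n)%:C%C).
  apply: (@cvgD C R[i]^o); first exact: cRe.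
  by apply: (@cvgMl_tmp C); exact: cIm.
apply/funext => n; rewrite !seriesEnat /= !rmorph_sum mulr_sumr -big_split /=.
by apply: eq_bigr => k _; apply: complexE.
Qed.

Lemma csummable_tail (u : nat -> C) N :
  csummable (fun n => u (n + N)%N) -> csummable u.
Proof.
move=> /has_csum_csum; move: (csum _) => s us; apply/cvg_ex.
exists (series u N + s); rewrite -(cvg_shiftn N).
rewrite (_ : [sequence _]_n = fun n => series u N + series (fun n => u (n + N)%N) n).
  by apply: (@cvgD C R[i]^o); [exact: cvg_cst | exact: us].
apply/funext => n; rewrite !seriesEnat /= (@big_cat_nat _ _ _ N) ?leq_addl //=.
by congr (_ + _); rewrite -{1}[N]add0n big_addn addnK.
Qed.

(** The ratio test without division, so that vanishing terms are allowed. *)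
Lemma csummable_ratio (u : nat -> C) (rho : nat -> R) (l : R) :
  (\forall n \near \oo, normc (u n.+1) <= rho n * normc (u n))%classic ->
  (rho @ \oo --> l)%classic -> l < 1 -> csummable u.
Proof.
move=> urho rhol l1; pose r := (1 + Num.max 0 l) / 2.
have m1 : Num.max 0 l < 1 by rewrite gt_max ltr01.
have r1 : r < 1 by rewrite /r; lra.
have r0 : 0 <= r by rewrite divr_ge0 // addr_ge0 // le_max lexx.
have lr : l < r.
  have : l <= Num.max 0 l by rewrite le_max lexx orbT.
  rewrite /r; lra.
have [N _ uN] : (\forall n \near \oo, normc (u n.+1) <= r * normc (u n))%classic.
  have rho_r : (\forall n \near \oo, rho n < r)%classic.
    have /cvgrPdist_lt /(_ (r - l)) := rhol; rewrite subr_gt0 => /(_ lr).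
    by apply: filterS => n; rewrite ltr_norml => /andP[+ _]; lra.
  apply: filterS2 urho rho_r => n un rn; apply: (le_trans un).
  by rewrite ler_wpM2r ?normc_ge0 // ltW.
apply: (@csummable_tail _ N); apply: (@csummable_dom _ (geometric (normc (u N)) r)).
  elim=> [|n IH]; first by rewrite add0n /= expr0 mulr1.
  rewrite addSn; apply: (le_trans (uN _ _)); first exact: leq_addl.
  by rewrite /= exprS mulrCA ler_wpM2l.
by apply: is_cvg_geometric_series; rewrite ger0_norm.
Qed.
End ComplexSeries.

(** * Convergence of the moments *)

Section Growth.
Variable R : realType.
Local Notation C := R[i].
Local Notation normc := (@ComplexField.Normc.normc R).

Lemma normc_nat n : normc n%:R = n%:R.
Proof. by apply: complexI; rewrite -[LHS]/(`|n%:R : C|) normr_nat rmorph_nat. Qed.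

Lemma le_normcD (x y : C) : normc (x + y) <= normc x + normc y.
Proof. by rewrite -lecR rmorphD; apply: (ler_normD x y). Qed.

Lemma normcX (z : C) m : normc (z ^+ m) = normc z ^+ m.
Proof. by apply: complexI; rewrite rmorphXn; exact: (normrX m z). Qed.

Lemma normc_prod (s : seq C) (f : C -> C) :
  normc (\prod_(u <- s) f u) = \prod_(u <- s) normc (f u).
Proof.
apply: (big_morph normc); first exact: ComplexField.Normc.normcM.
exact: ComplexField.Normc.normc1.
Qed.

(** The factors of a hypergeometric ratio, normalised so as to tend to 1. *)
Definition growth (u : C) (x : nat) : R := normc (u + x%:R) / x.+1%:R.

(** The numerator differs from x + 1 by at most the modulus of u - 1. *)
Lemma cvg_growth u : (growth u @ \oo --> (1 : R))%classic.
Proof.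
pose k := normc (u - 1).
have kE : normc (1 - u) = k.
  by apply: complexI; exact: (distrC (1 : C) u).
apply: (@squeeze_cvgr _ _ _ _ (fun x => 1 - k * harmonic x)
          (fun x => 1 + k * harmonic x)).
- near=> x; rewrite /growth /harmonic /=.
  have x0 : 0 < (x.+1%:R : R) by rewrite ltr0n.
  rewrite ler_pdivlMr // ler_pdivrMr // mulrBl mulrDl divfK ?gt_eqF // !mul1r.
  have := le_normcD (u - 1) x.+1%:R.
  have := le_normcD (1 - u) (u + x%:R).
  rewrite kE -/k (_ : 1 - u + (u + x%:R) = x.+1%:R); last first.
    by rewrite addrA subrK mulrS.
  rewrite (_ : u - 1 + x.+1%:R = u + x%:R); last by rewrite mulrS addrA subrK.
  rewrite normc_nat; move: (normc (u + _)) (x.+1%:R) => g y h1 h2.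
  by apply/andP; split; lra.
- rewrite -[X in (_ --> X)%classic]subr0 -[X in _ - X](mulr0 k).
  by apply: cvgB; [exact: cvg_cst | apply: cvgMl_tmp; exact: cvg_harmonic].
- rewrite -[X in (_ --> X)%classic]addr0 -[X in _ + X](mulr0 k).
  by apply: cvgD; [exact: cvg_cst | apply: cvgMl_tmp; exact: cvg_harmonic].
Unshelve. all: by end_near. Qed.

Lemma cvg_prod_growth (s : seq C) :
  ((fun x => \prod_(u <- s) growth u x) @ \oo --> (1 : R))%classic.
Proof.
elim: s => [|u s IH].
  rewrite (_ : (fun _ => _) = fun=> 1); first exact: cvg_cst.
  by apply/funext => x; rewrite big_nil.
rewrite (_ : (fun _ => _) = fun x => growth u x * \prod_(v <- s) growth v x).
  by rewrite -[X in (_ --> X)%classic]mulr1; apply: cvgM IH; apply: cvg_growth.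
by apply/funext => x; rewrite big_cons.
Qed.

Lemma prod_normc_growth (s : seq C) x :
  \prod_(u <- s) normc (u + x%:R)
  = x.+1%:R ^+ size s * \prod_(u <- s) growth u x.
Proof.
elim: s => [|u s IH]; first by rewrite !big_nil mulr1.
rewrite !big_cons IH /growth [size _]/= exprS [RHS]mulrACA.
by rewrite [_ * (_ / _)]mulrC divfK // pnatr_eq0.
Qed.

Lemma cvg_exp (f : nat -> R) (l : R) n :
  (f @ \oo --> l -> (fun x => f x ^+ n) @ \oo --> l ^+ n)%classic.
Proof.
move=> fl; elim: n => [|n IH]; first exact: cvg_cst.
rewrite (_ : (fun _ => _) = fun x => f x * f x ^+ n).
  by rewrite exprS; apply: cvgM.
by apply/funext => x; rewrite exprS.
Qed.

Lemma ratio_rearrange (y z A B d h : R) (i j k n : nat) :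
  y != 0 -> z != 0 -> y ^+ i * y ^+ k = y ^+ j * y ->
  y ^+ n * (h * (y ^+ i * A / (y ^+ j * B) * (d / y)))
  = (z / y)^-1 ^+ n * (A * B^-1 * (d * y^-1 ^+ k)) * (z ^+ n * h).
Proof.
move=> y0 z0; rewrite invf_div expr_div_n exprVn [(y ^+ j * B)^-1]invfM.
have := expf_neq0 n z0; have := expf_neq0 k y0; have := expf_neq0 j y0.
move: (y ^+ i) (y ^+ j) (y ^+ k) (y ^+ n) (z ^+ n) B^-1 => a b c e f B'.
move=> b0 c0 f0 abc; have -> : a = b * y / c by rewrite -abc mulfK.
by field; rewrite y0 b0 c0 f0.
Qed.

(** The modulus of the ratio of consecutive terms is a product of normalised factors tending
to 1, times |c| / (x + 1)^k with k = size b + 1 - size a.  Its limit is 0 if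
k > 0, and |c| otherwise.  The factor x^n contributes
((x + 1) / x)^n, that is a power of the inverse of [growth 0 x]. *)
Lemma csummable_hyp_term (a b : seq C) c n :
  (size a <= (size b).+1)%N -> (size a = (size b).+1 -> `|c| < 1) ->
  csummable (fun x => x%:R ^+ n * hyp_term a b c x).
Proof.
move=> ab c1; set k := ((size b).+1 - size a)%N.
pose rho x := (growth 0 x)^-1 ^+ n *
  ((\prod_(u <- a) growth u x) * (\prod_(v <- b) growth v x)^-1
   * (normc c * harmonic x ^+ k)).
apply: (@csummable_ratio _ _ rho (1^-1 ^+ n * (1 * 1^-1 * (normc c * 0 ^+ k)))).
- near=> x; have x0 : (0 < x)%N by near: x; exists 1%N.
  (* x > 0, for the term of index 0 vanishes when n > 0 *)
  rewrite hyp_termS !ComplexField.Normc.normcM !ComplexField.Normc.normcV.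
  rewrite !normc_prod !prod_normc_growth !normcX !normc_nat /rho.
  rewrite (_ : growth 0 x = x%:R / x.+1%:R); last by rewrite /growth add0r normc_nat.
  rewrite [harmonic x]/=.
  rewrite le_eqVlt; apply/orP; left; apply/eqP.
  apply: ratio_rearrange; rewrite ?pnatr_eq0 -?lt0n // -exprD -exprSr.
  by rewrite subnKC.
- apply: cvgM; last apply: cvgM; last apply: cvgM.
  + by apply: cvg_exp; apply: cvgV; rewrite ?oner_eq0 //; exact: cvg_growth.
  + apply: cvgM; first exact: cvg_prod_growth.
    by apply: cvgV; rewrite ?oner_eq0 //; exact: cvg_prod_growth.
  + exact: cvg_cst.
  + by apply: cvg_exp; exact: cvg_harmonic.
- rewrite invr1 expr1n !mul1r expr0n; case: eqP => k0; last by rewrite mulr0.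
  rewrite mulr1 -ltcR; apply: c1; apply/eqP; rewrite eqn_leq ab /=.
  by rewrite -subn_eq0 -/k k0.
Unshelve. all: by end_near. Qed.

Lemma csummable_finite (u : nat -> C) N :
  (forall x, (N < x)%N -> u x = 0) -> csummable u.
Proof.
move=> u0; apply: (@csummable_ratio _ u (fun=> 0) 0) => //; last exact: cvg_cst.
exists N => // x /= Nx; rewrite u0 //.
by rewrite ComplexField.Normc.normc0 mul0r.
Qed.

End Growth.

(** The condition beta_j > -1 makes the denominators nonzero. *)
Lemma pearson_hyp_term (R : realType) (p q : nat)
    (alpha : p.-tuple R[i]) (beta : q.-tuple R)
    (hbeta : forall j : 'I_q, -1 < tnth beta j) x :
  let a := hyp_term alpha (shift_beta beta) 1 in
  x.+1%:R * \prod_(j < q)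
     (x.+1%:R + tnth (map_tuple (fun b => (b%:C)%C) beta) j) * a x.+1
  = \prod_(i < p) (x%:R + tnth alpha i) * a x.
Proof.
move=> a; rewrite /a hyp_termS -/(a x) big_tuple /shift_beta big_map big_tuple.
have -> : \prod_(j < q) (x.+1%:R + tnth (map_tuple (fun b => (b%:C)%C) beta) j)
  = \prod_(j < q) ((tnth beta j)%:C%C + 1 + x%:R) :> R[i].
  by apply: eq_bigr => j _; rewrite tnth_map [LHS]addrC mulrS addrA.
have -> : \prod_(i < p) (tnth alpha i + x%:R) = \prod_(i < p) (x%:R + tnth alpha i).
  by apply: eq_bigr => i _; rewrite addrC.
have B0 : \prod_(j < q) ((tnth beta j)%:C%C + 1 + x%:R) != 0 :> R[i].
  apply/prodf_neq0 => j _.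
  rewrite -(rmorph1 (real_complex R)) -(rmorph_nat (real_complex R)) -!rmorphD /=.
  rewrite fmorph_eq0 gt_eqF // ltr_wpDr ?ler0n //.
  by rewrite -[X in X < _](addNr 1) ltrD2r.
have x0 : x.+1%:R != 0 :> R[i] by rewrite pnatr_eq0.
move: (\prod_(_ < p) _) (\prod_(_ < q) _) (a x) (x.+1%:R) B0 x0 => A B w y B0 y0.
by rewrite mulrA mulrACA; field; rewrite B0 y0.
Qed.

(** * Expansion of the right-hand side at infinity *)

(** The expansion w z / (z - y) = w (1 + y / z + y^2 / z^2 + ...).  The
coefficients satisfy r_(k-1) = y r_k for k <> 1 and r_0 = y r_1 + w, and
vanish in degree at least 2, hence also in degree 1. *)
Lemma ratfrac_coef_geom (K : fieldType) (f : {fraction {poly K}}) (y w : K) :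
  f = FracField.tofrac (w *: 'X) / FracField.tofrac ('X - y%:P) ->
  (forall n : nat, ratfrac_coef f (- n%:Z) = y ^+ n * w) /\
  (forall m : nat, ratfrac_coef f m.+1%:Z = 0).
Proof.
move=> /(ratfrac_coefP (negbT (polyXsubC_eq0 y))) [rec vanish].
have {}rec k : ratfrac_coef f (k - 1) = y * ratfrac_coef f k
                 + (if k is Posz m then (m == 1%N)%:R * w else 0).
  have := rec k; rewrite size_XsubC !big_ord_recl big_ord0 addr0 /=.
  rewrite !coefB !coefX !coefC /= sub0r !subr0 mul1r addr0 /bump /= => /eqP.
  rewrite mulNr addrC subr_eq => /eqP ->; rewrite addrC; congr (_ + _).
  by case: k => // m; rewrite coefZ coefX mulrC.
have r1 m : ratfrac_coef f m.+1%:Z = 0.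
  have r2 k : ratfrac_coef f k.+2%:Z = 0.
    by apply: vanish; rewrite (leq_trans (size_scale_leq _ _)) // size_polyX.
  case: m => // ; have := rec 2%:Z; rewrite r2 mulr0 mul0r addr0; exact.
split=> //; elim=> [|n IH].
  by have := rec 1%:Z; rewrite r1 mulr0 eqxx !mul1r add0r => <-.
have -> : - n.+1%:Z = - n%:Z - 1 by rewrite -addn1 PoszD opprD.
rewrite rec IH exprS mulrA [X in _ + X](_ : _ = 0) ?addr0 //.
by case: n {IH} => [|n] //=; rewrite mul0r.
Qed.

Lemma frac_rescale (F : fieldType) (g y t l : F) : l != 0 ->
  y / l / (y / l - t) * g = g * y / (y - l * t).
Proof.
move=> l0; have -> : y / l - t = (y - l * t) / l.
  by rewrite mulrBl [l * t]mulrC mulfK.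
by rewrite invf_div mulrA divfK // mulrC mulrA.
Qed.

(** With w = z / L, [pochhammer_ratio] turns the factor that depends on z into
z / (z - L x). *)
Lemma rhs_termE (R : realType) (p q : nat)
    (alpha : p.-tuple R[i]) (beta : q.-tuple R) (c L : R[i]) x :
  L = lambda _ p q + tau _ p q * c -> L != 0 ->
  rhs_term alpha beta c x
  = FracField.tofrac (hyp_term alpha (shift_beta beta) c x *: 'X)
    / FracField.tofrac ('X - (L * x%:R)%:P).
Proof.
move=> LE L0; rewrite /rhs_term -LE.
pose C : {rmorphism R[i] -> {fraction {poly R[i]}}} :=
  (@FracField.tofrac {poly R[i]}) \o (@polyC R[i]).
rewrite hyp_term_cons (hyp_term_map C) /=.
set X := FracField.tofrac 'X; set h := hyp_term _ _ _ _.
have CL0 : C L != 0 by rewrite fmorph_eq0.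
have DE i : FracField.tofrac ('X - (L * i%:R)%:P) = X - C L * i%:R.
  by rewrite rmorphB -(rmorph_nat C) -rmorphM.
have wE i : X - C L * i%:R != 0.
  by rewrite -DE tofrac_eq0 polyXsubC_eq0.
rewrite pochhammer_ratio; last first.
  move=> i; apply: contra (wE i) => /eqP e.
  by rewrite -[X](divfK CL0) [X / C L]e mulrC subrr.
have -> : FracField.tofrac (h *: 'X) = C h * X by rewrite -mul_polyC rmorphM.
rewrite DE; exact: (frac_rescale (C h) X x%:R CL0).
Qed.

Lemma horner_lambda_ctau (K : fieldType) p q (c : K) :
  (lambda_ctau K p q).[c] = lambda _ p q + tau _ p q * c.
Proof.
by rewrite /lambda_ctau /lambda /tau !hornerE mulrC;
   case: ifP; case: ifP; rewrite ?hornerE //; case: ifP; rewrite ?hornerE.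
Qed.

Theorem mainTheorem3 (R : realType) (p q : nat)
    (alpha : p.-tuple R[i]) (beta : q.-tuple R) (c : R[i])
    (hbeta : forall j : 'I_q, -1 < tnth beta j)
    (hc_eq : p = q.+1 -> `|c| < 1)
    (hc_gt : (q.+1 < p)%N ->
       c != 0 /\
       exists (i : 'I_p) (N : nat), (0 < N)%N /\ tnth alpha i = - N%:R) :
  [/\ (forall n : nat, csummable (moment_term alpha beta c n)),
      (forall k : int,
         csummable (fun x => ratfrac_coef (rhs_term alpha beta c x) k))
    & (fun k : int =>
         dot (stieltjes alpha
                (map_tuple (fun b => (b%:C)%C) beta) c k)
             (moment_vec alpha beta c))
      =1 laurent_divz (rhs_series alpha beta c)].
Proof.
have moment_sum n : csummable (moment_term alpha beta c n).
  have [qp|pq] := ltnP q.+1 p.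
    have [_ [i [N [_ iN]]]] := hc_gt qp.
    apply: (@csummable_finite _ _ N) => x Nx.
    rewrite /moment_term (@hyp_term_negn _ _ _ _ N) ?mulr0 //.
    by rewrite -iN mem_tnth.
  apply: csummable_hyp_term; rewrite size_map !size_tuple //.
set L : R[i] := lambda _ p q + tau _ p q * c.
have L0 : L != 0.
  rewrite /L /lambda /tau; case: (ltngtP p q.+1) => [pq|qp|pq].
  - by rewrite mul0r addr0 oner_neq0.
  - by rewrite add0r mul1r; case: (hc_gt qp).
  - rewrite mulN1r subr_eq0; apply: contraTneq (hc_eq pq) => <-.
    by rewrite normr1 ltxx.
have rhs_coef x := ratfrac_coef_geom (rhs_termE alpha beta x (erefl L) L0).
have rhs_neg n : (fun x => ratfrac_coef (rhs_term alpha beta c x) (- n%:Z))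
                 = (fun x => L ^+ n * moment_term alpha beta c n x).
  by apply/funext => x; rewrite (rhs_coef x).1 exprMn -mulrA.
have rhs_pos m : (fun x => ratfrac_coef (rhs_term alpha beta c x) m.+1%:Z)
                 = (fun=> 0).
  by apply/funext => x; rewrite (rhs_coef x).2.
have rhs_sum n : has_csum
    (fun x => ratfrac_coef (rhs_term alpha beta c x) (- n%:Z))
    (L ^+ n * moment alpha beta c n).
  by rewrite rhs_neg; apply/has_csumZ/has_csum_csum.
split=> [//|k|k].
- case: k => [[|m]|n].
  + exact: (has_csum_summable (rhs_sum 0%N)).
  + by rewrite rhs_pos; exact: (has_csum_summable (@has_csum0 R)).
  + by rewrite NegzE; exact: (has_csum_summable (rhs_sum n.+1)).
case: k => [m|n]; rewrite /laurent_divz /rhs_series /dot.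
  rewrite -PoszD addn1 rhs_pos (has_csum_unique (@has_csum0 R)).
  by rewrite big1 // => i _; rewrite mxE mul0r.
have -> : Negz n + 1 = - n%:Z by rewrite NegzE -addn1 PoszD opprD addrNK.
rewrite (has_csum_unique (rhs_sum n)).
(* Both sides are sums of series in c whose terms agree by [conv_P_vec]. *)
set beta' := map_tuple _ _.
pose a := hyp_term alpha (shift_beta beta) 1.
have mom_conv (f : {poly R[i]}) m : has_csum
    (fun d => conv f (fun x => x%:R ^+ m * a x) d * c ^+ d)
    (f.[c] * moment alpha beta c m).
  apply: has_csum_conv; rewrite (_ : (fun _ => _) = moment_term alpha beta c m).
    exact: has_csum_csum.
  by apply/funext => x; rewrite /moment_term hyp_term_scale mulrA.
transitivity (\sum_(i < (xi p q).+1)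
    (P_vec alpha beta' n i 0).[c] * moment alpha beta c i).
  by apply: eq_bigr => i _; rewrite !mxE.
have := @has_csum_sum R _ (index_enum _) _ _
          (fun i : 'I_(xi p q).+1 => mom_conv (P_vec alpha beta' n i 0) i).
move/has_csum_unique => <-.
have -> : L ^+ n = (lambda_ctau R[i] p q ^+ n).[c].
  by rewrite horner_exp horner_lambda_ctau.
rewrite -(has_csum_unique (mom_conv _ n)); congr csum; apply/funext => d.
rewrite -mulr_suml (conv_P_vec (beta := beta')) //.
exact: pearson_hyp_term.
Qed.
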